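(* Let $k$ be an algebraically closed field. For each positive integer $d$ there exist real numbers $a>0$ and $b$ such that for every positive integer $n$, if $Q\in k\langle x_1,\ldots,x_n\rangle$ is a (non-zero) non-commutative polynomial of degree $d$, then for all positive integers $s$ the codimension of $$M_{s,Q}:=\{\mathbf{r}\in M_s(k)^n\mid Q(\mathbf{r})=0\}$$ in $M_s(k)^n$ is at least $as^2+b$.
   Context: $k$ is an algebraically closed field of arbitrary characteristic. $k\langle x_1,\ldots,x_n\rangle$ is the free associative unital $k$-algebra; $M_s(k)$ is the algebra of $s\times s$ matrices, and $M_s(k)^n$ is regarded as an affine space of dimension $ns^2$. The codimension of an algebraic set $X$ in it is $ns^2-\dim X$, the empty set having infinite codimension. *)

(* Defs.v *)
(* Built on MathComp, with mathcomp-multinomials for polynomials and           *)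
(* MathComp-Analysis for sets and extended reals.                              *)
(* mpoly must be imported before ereal: the opposite order makes their         *)
(* notations clash. monalg also has a notation {mpoly R[n]}, for a different   *)
(* type, and shares names such as msupp with mpoly.                            *)
From mathcomp Require Import all_boot all_order all_algebra finmap.
From mathcomp Require Import -(notations) monalg.
From mathcomp Require Import mpoly.
From mathcomp Require Import boolp classical_sets reals constructive_ereal ereal.

Set Implicit Arguments.
Unset Strict Implicit.
Unset Printing Implicit Defensive.

Import Order.TTheory GRing.Theory Num.Theory.

Local Open Scope classical_set_scope.
Local Open Scope ring_scope.

Section ZariskiDimension.
Context {k : fieldType} {N : nat}.
Implicit Types (P : set {mpoly k[N]}) (X Y Z : set 'rV[k]_N).

Definition zero_locus P : set 'rV[k]_N :=
  [set v | forall p, P p -> meval (v ord0) p = 0].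

Definition algebraic_set X := exists P, X = zero_locus P.

Definition irreducible_set X :=
  X !=set0 /\
  forall Y Z, algebraic_set Y -> algebraic_set Z ->
    X `<=` Y `|` Z -> X `<=` Y \/ X `<=` Z.

(* C 0, ..., C m is a strictly increasing chain of irreducible closed subsets  *)
(* of X; the values C i for i > m are irrelevant. For an algebraic set X, the  *)
(* closed subsets of the space X are the algebraic sets contained in X.        *)
Definition irreducible_chain X (m : nat) (C : nat -> set 'rV[k]_N) :=
  (forall i, (i <= m)%N ->
     [/\ algebraic_set (C i), irreducible_set (C i) & C i `<=` X]) /\
  (forall i, (i < m)%N -> C i `<` C i.+1).

(* Krull dimension, meaningful for X algebraic. It lies in \bar R so that the  *)
(* empty set has dimension -oo, hence codimension +oo.                         *)
Definition alg_dim (R : realType) X : \bar R :=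
  ereal_sup [set m%:R%:E | m in [set m | exists C, irreducible_chain X m C]].

Definition alg_codim (R : realType) X : \bar R := (N%:R%:E - alg_dim R X)%E.

End ZariskiDimension.

(* The monoid algebra over k of the free monoid on 'I_n, i.e. k<x_1, ..., x_n>. *)
Definition ncpoly (k : fieldType) (n : nat) :=
  monalg.malg (monalg.fmonom 'I_n) k.

(* The zero polynomial gets degree 0. *)
Definition ncdegree (k : fieldType) (n : nat) (Q : ncpoly k n) : nat :=
  \max_(w <- monalg.msupp Q) monalg.fdeg w.

(* monalg.mmap does not apply: its codomain must be a nontrivial ring, and     *)
(* 'M_s is only known to be one for s of the form s'.+1.                       *)
Definition nceval (k : fieldType) (n s : nat) (r : {ffun 'I_n -> 'M[k]_s})
    (Q : ncpoly k n) : 'M[k]_s :=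
  \sum_(w <- monalg.msupp Q)
    monalg.mcoeff w Q *: \big[mulmx/1%:M]_(i <- w) r i.

Definition mx_coords (k : fieldType) (n s : nat) (r : {ffun 'I_n -> 'M[k]_s}) :
    'rV[k]_(n * (s * s)) :=
  mxvec (\matrix_(i < n) mxvec (r i)).

Definition mx_codim (k : fieldType) (R : realType) (n s : nat)
    (X : set {ffun 'I_n -> 'M[k]_s}) : \bar R :=
  alg_codim R [set mx_coords r | r in X].

Definition MsQ (k : fieldType) (n s : nat) (Q : ncpoly k n) :
    set {ffun 'I_n -> 'M[k]_s} :=
  [set r | nceval r Q = 0].
Arguments MsQ {k n} s Q.

(* Main.v *)
Require Import Defs.
From mathcomp Require Import all_boot all_order all_algebra finmap.
From mathcomp Require Import -(notations) monalg.
From mathcomp Require Import mpoly.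
From mathcomp Require Import boolp classical_sets reals constructive_ereal ereal.
From mathcomp Require Import zify ring lra.

(** The bound comes from leading monomials.  Suppose that polynomials f_1, ...,
    f_c vanish on X and that, for a positive weight on the variables, each f_j
    has a single monomial of maximal weight, these leading monomials being
    squarefree and pairwise coprime.  Then X has codimension at least c
    ([chain_length_bound]).  Indeed, rewriting each leading monomial by lighter
    ones shows that every polynomial agrees on X with a combination of standard
    monomials, those divisible by no leading monomial ([standard_reduction]).
    A standard monomial misses a variable of each of the c leading monomials,
    so there are only O(D^(N-c)) of them of weight less than D
    ([card_standard]).  A chain of r + 1 irreducible closed subsets of X yields
    r polynomials whose power products are linearly independent on X
    ([chain_independent]), which is order of D^r independent functions of
    weight at most D.  Hence r <= N - c.

    For M_{s,Q} the f_j are entries of Q evaluated at generic matrices.  Choose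
    a word w = l_0 ... l_(d-1) of maximal length in the support of Q.  The
    (p, q) entry of Q is a sum over the words u of Q and the walks from p to q
    of length |u| in {0, ..., s-1}; the step from i to j labelled by the letter
    l contributes the variable x_(l,i,j).  Cut the nodes into layers of size M
    and give x_(l,i,j) the weight s^2 + [l = l_(i / M)] - (j - i)^2.  Since the
    square is strictly convex, the heaviest walk of length d from p to q = p +
    d * step is the arithmetic progression, provided that it visits each layer
    in turn, and the bracket forces it to be labelled by w.  Shorter words cannot
    compete: they have fewer edges and pay for longer ones.  So the term of w
    along this progression is the unique heaviest one ([nceval_lead]), and its
    coefficient is that of w in Q.

    Take p < m and step = M + e with e < m, where m = s / (d+1)^2 and M =
    (d+1) m.  A single edge of such a progression determines its layer, hence
    step and p, so the m^2 leading monomials are squarefree and pairwise coprime.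
    Thus the codimension is at least m^2, which grows like s^2 / (d+1)^4. *)

Import Order.TTheory GRing.Theory Num.Theory.

Local Open Scope ring_scope.

(** * Weighted degree and supports of polynomials *)

Section Weights.
Context {N : nat}.
Variable w : 'I_N -> nat.
Implicit Types m : 'X_{1..N}.

Definition wdeg m : nat := (\sum_i w i * m i)%N.

Lemma wdeg0 : wdeg 0%MM = 0%N.
Proof. by rewrite /wdeg big1 // => i _; rewrite mnm0E muln0. Qed.

Lemma wdegD m1 m2 : wdeg (m1 + m2)%MM = (wdeg m1 + wdeg m2)%N.
Proof.
by rewrite /wdeg -big_split; apply: eq_bigr => i _; rewrite mnmDE mulnDr.
Qed.

Lemma wdeg1 i : wdeg U_(i)%MM = w i.
Proof.
rewrite /wdeg (bigD1 i) //= mnm1E eqxx muln1 big1 ?addn0 // => j ji.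
by rewrite mnm1E eq_sym (negPf ji) muln0.
Qed.

Lemma mdeg_le_wdeg m : (forall j, 0 < w j)%N -> (mdeg m <= wdeg m)%N.
Proof.
move=> w0; rewrite mdegE leq_sum // => i _.
by rewrite -[X in (X <= _)%N]mul1n leq_mul2r w0 orbT.
Qed.

End Weights.

Section Supported.
Context {k : fieldType} {N : nat}.
Implicit Types (S : pred 'X_{1..N}) (p q : {mpoly k[N]}).

Definition supported S p := {subset msupp p <= S}.

Lemma supported_sub S S' p :
  (forall m, S m -> S' m) -> supported S p -> supported S' p.
Proof. by move=> sSS' Sp m /Sp; apply: sSS'. Qed.

Lemma supported0 S : supported S 0.
Proof. by move=> m; rewrite msupp0. Qed.

Lemma supportedD S p q : supported S p -> supported S q -> supported S (p + q).
Proof. by move=> Sp Sq m /msuppD_le; rewrite mem_cat => /orP[/Sp|/Sq]. Qed.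

Lemma supportedZ S c p : supported S p -> supported S (c *: p).
Proof. by move=> Sp m /msuppZ_le /Sp. Qed.

Lemma supported_sum S (I : Type) (r : seq I) (P : pred I)
    (F : I -> {mpoly k[N]}) :
  (forall i, P i -> supported S (F i)) ->
  supported S (\sum_(i <- r | P i) F i).
Proof.
by move=> SF; elim/big_rec: _ => [|i p /SF]; [exact: supported0|exact: supportedD].
Qed.

Lemma supportedX S m : S m -> supported S 'X_[m].
Proof. by move=> Sm m' /mem_msuppXP <-. Qed.

Lemma supportedM S S1 S2 p q :
    (forall m1 m2, S1 m1 -> S2 m2 -> S (m1 + m2)%MM) ->
  supported S1 p -> supported S2 q -> supported S (p * q).
Proof.
by move=> H Sp Sq m /msuppM_le /allpairsP[[m1 m2] /= [/Sp H1 /Sq H2 ->]]; exact: H.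
Qed.

End Supported.

(** * Linear independence of polynomial functions on a set *)

Section LinearIndependence.
Context {k : fieldType} {N : nat}.

Definition independent_on (X : set 'rV[k]_N) (A : finType)
    (h : A -> {mpoly k[N]}) :=
  forall u : A -> k,
    (forall v, X v -> \sum_a u a * (h a).@[v ord0] = 0) -> forall a, u a = 0.

(** Otherwise the coordinates of the [h a] in the spanning family would have a
    nontrivial linear relation, and so would the [h a] themselves. *)
Lemma independent_on_card (X : set 'rV[k]_N) (A S : finType)
    (h : A -> {mpoly k[N]}) (e : S -> {mpoly k[N]}) (c : A -> S -> k) :
    (forall a v, X v ->
       (h a).@[v ord0] = \sum_s c a s * (e s).@[v ord0]) ->
  independent_on X A h -> (#|A| <= #|S|)%N.
Proof.
move=> hE indh.
pose M := \matrix_(i < #|A|, j < #|S|) c (enum_val i) (enum_val j).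
suff /eqP <- : row_free M by exact: rank_leq_col.
apply: inj_row_free => u uM0.
have u0 : forall a, u 0 (enum_rank a) = 0.
  apply: indh => v Xv.
  under eq_bigr => a _ do rewrite hE // mulr_sumr.
  rewrite exchange_big /= big1 // => s _.
  have := congr1 (fun B : 'rV_ _ => B 0 (enum_rank s)) uM0.
  rewrite !mxE (reindex enum_rank) /=; last by apply: onW_bij; exact: enum_rank_bij.
  under eq_bigr => a _ do rewrite mxE !enum_rankK.
  move=> us0; under eq_bigr => a _ do rewrite mulrA.
  by rewrite -mulr_suml us0 mul0r.
by apply/rowP => i; rewrite mxE -[i]enum_valK u0.
Qed.

End LinearIndependence.

(** * Standard monomials modulo leading monomials *)

Section StandardMonomials.
Context {k : fieldType} {N : nat} (w : 'I_N -> nat) (J : finType).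
Variables (B : J -> {set 'I_N}) (X : set 'rV[k]_N).

Definition standard (m : 'X_{1..N}) : bool :=
  [forall j, [exists i in B j, m i == 0%N]].

Definition block_monomial (j : J) : 'X_{1..N} := (\sum_(i in B j) U_(i))%MM.

Lemma block_monomialE j i : block_monomial j i = (i \in B j) :> nat.
Proof.
rewrite mnm_sumE; under eq_bigr => i' _ do rewrite mnm1E.
have [iB|iB] := boolP (i \in B j).
  by rewrite (bigD1 i) //= eqxx big1 // => i' /andP[_ /negPf ->].
by rewrite big1 // => i' i'B; case: eqP iB => // <-; rewrite i'B.
Qed.

Lemma not_standardP m :
  ~~ standard m -> exists j, exists m', m = (m' + block_monomial j)%MM.
Proof.
rewrite negb_forall => /existsP[j]; rewrite negb_exists_in => /forall_inP mB.
exists j, (m - block_monomial j)%MM; rewrite submK //.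
by apply/mnm_lepP => i; rewrite block_monomialE; 
  case: (boolP (i \in B j)) => // /mB; rewrite lt0n.
Qed.

(** On [X], each block monomial can be traded for lighter monomials: this is
    what an equation of [X] with that leading monomial provides. *)
Definition block_reducible := forall j, exists2 g : {mpoly k[N]},
  supported (fun m => wdeg w m < wdeg w (block_monomial j))%N g &
  forall v, X v -> 'X_[block_monomial j].@[v ord0] = g.@[v ord0].

(** Rewriting a block monomial inside a nonstandard monomial strictly lowers
    the weight, so the rewriting terminates and never leaves the weight bound. *)
Lemma standard_reduction (D : nat) (p : {mpoly k[N]}) :
    block_reducible -> supported (fun m => wdeg w m < D)%N p ->
  exists2 q, supported (fun m => (wdeg w m < D)%N && standard m) q &
    forall v, X v -> p.@[v ord0] = q.@[v ord0].
Proof.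
move=> redB; elim: D p => [|D IH] p Dp.
  by exists p => // m /Dp.
have redX m : (wdeg w m < D.+1)%N ->
    exists2 q, supported (fun m => (wdeg w m < D.+1)%N && standard m) q &
    forall v, X v -> ('X_[m] : {mpoly k[N]}).@[v ord0] = q.@[v ord0].
  move=> mD; have [stdm|/not_standardP[j [m' mE]]] := boolP (standard m).
    by exists 'X_[m] => //; apply: supportedX; rewrite mD.
  have [g gsupp gE] := redB j.
  have [|q qsupp qE] := IH ('X_[m'] * g).
    apply: (@supportedM _ _ _ (pred1 m') _ _ _ _ _ gsupp).
      move=> _ m2 /eqP -> /= m2lt; move: mD.
      by rewrite mE !wdegD ltnS; apply: leq_trans; rewrite ltn_add2l.
    by apply: supportedX => /=.
  exists q; first by apply: supported_sub qsupp => m0 /andP[m0D ->]; rewrite ltnW.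
  by move=> v Xv; rewrite mE mpolyXD mevalM gE // -mevalM qE.
rewrite [p]mpolyE big_seq; elim/big_rec: _ => [|m p1 mp [q qsupp qE]].
  by exists 0 => //; exact: supported0.
have [qm qmsupp qmE] := redX m (Dp m mp).
exists (p@_m *: qm + q); first by apply: supportedD => //; exact: supportedZ.
by move=> v Xv; rewrite !mevalD !mevalZ qE // qmE.
Qed.

(** A standard monomial misses some variable [t j] of each block; the [t j]
    are distinct as the blocks are disjoint.  There are at most [N ^ #|J|]
    choices of [t], and for each of them [N - #|J|] free exponents. *)
Lemma card_standard (D : nat) :
    (forall i j j', i \in B j -> i \in B j' -> j = j') ->
  (#|[pred m : 'X_{1..N < D.+1} | standard m]| <=
    N ^ #|J| * D.+1 ^ (N - #|J|))%N.
Proof.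
move=> disjB.
pose code (m : 'X_{1..N < D.+1}) : {ffun 'I_N -> 'I_D.+1} := [ffun i => inord (m i)].
have codeE (m : 'X_{1..N < D.+1}) i : code m i = m i :> nat.
  rewrite ffunE inordK //; apply: leq_ltn_trans (bmdeg m).
  by rewrite mdegE (bigD1 i) //= leq_addr.
have code_inj : injective code.
  move=> m m' mm'; apply: val_inj; apply/mnmP => i /=.
  by rewrite -!codeE mm'.
pose T := {ffun J -> 'I_N}.
pose F (t : T) := [set f : {ffun 'I_N -> 'I_D.+1} | [forall j, f (t j) == ord0]].
pose G := [set t : T | injectiveb t].
have sub : code @: [set m : 'X_{1..N < D.+1} | standard m] \subset (\bigcup_(t in G) F t).
  apply/fintype.subsetP => _ /imsetP[m /[!inE] /forallP stdm ->].
  have /fin_all_exists2[t tB tm] j : exists2 i, i \in B j & (m : 'X_{1..N}) i = 0%N.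
    by have /exists_inP[i iB /eqP mi] := stdm j; exists i.
  apply/finset.bigcupP; exists (finfun t); rewrite !inE.
    by apply/injectiveP => j j'; rewrite !ffunE => tjj';
      apply: (disjB (t j)); rewrite // tjj'.
  by apply/forallP => j; rewrite -val_eqE /= codeE ffunE tm.
rewrite -cardsE -(card_imset _ code_inj); apply: leq_trans (subset_leq_card sub) _.
have cardF (t : T) : t \in G -> (#|F t| <= D.+1 ^ (N - #|J|))%N.
  rewrite inE => /injectiveP t_inj.
  have -> : (N - #|J| = #|~: [set t j | j in J]|)%N.
    by rewrite cardsCs finset.setCK card_imset // card_ord.
  rewrite -[in leqRHS](card_ord D.+1) -(card_pffun_on ord0) subset_leq_card //.
  apply/fintype.subsetP => f; rewrite inE => /forallP ft.
  apply/pffun_onP; split=> [|i _]; last by [].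
  apply/fintype.subsetP => i; rewrite inE; apply: contraNT; rewrite inE negbK.
  by case/imsetP => j _ ->; exact: ft.
have card_cup : (#|(\bigcup_(t in G) F t)| <= \sum_(t in G) #|F t|)%N.
  elim/big_rec2: _ => [|t n U _ le]; first by rewrite cards0.
  by apply: leq_trans (leq_card_setU _ _) _; rewrite leq_add2l.
apply: (leq_trans card_cup).
apply: (@leq_trans (\sum_(t in G) D.+1 ^ (N - #|J|))); first exact: leq_sum.
rewrite sum_nat_const leq_mul2r; apply/orP; right.
by apply: leq_trans (max_card _) _; rewrite card_ffun card_ord.
Qed.

Lemma blocks_card_le :
    (forall i j j', i \in B j -> i \in B j' -> j = j') ->
    (forall j, B j != finset.set0) -> (#|J| <= N)%N.
Proof.
move=> disjB Bn0.
have /fin_all_exists[t tB] j : exists i, i \in B j by apply/set0Pn/Bn0.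
have t_inj : injective t.
  by move=> j j' tjj'; apply: (disjB (t j)); rewrite // tjj'.
by rewrite -[N in leqRHS]card_ord -(card_codom t_inj) max_card.
Qed.

End StandardMonomials.

(** * Independent functions from chains of irreducible sets *)

Section Chains.
Context {k : fieldType} {N : nat} (w : 'I_N -> nat).
Implicit Types (C : set 'rV[k]_N) (p q g : {mpoly k[N]}).

Lemma algebraic_zero_set p : algebraic_set [set v : 'rV[k]_N | p.@[v ord0] = 0]%classic.
Proof.
exists [set p]%classic; apply/seteqP; split=> [v pv _ -> //|v /= pv]; exact: pv.
Qed.

Lemma irreducible_mul C p q : irreducible_set C ->
    (forall v, C v -> (p * q).@[v ord0] = 0) ->
  (forall v, C v -> p.@[v ord0] = 0) \/ (forall v, C v -> q.@[v ord0] = 0).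
Proof.
move=> [_ irrC] pq0.
apply: irrC (algebraic_zero_set p) (algebraic_zero_set q) _ => v Cv.
by move/eqP: (pq0 v Cv); rewrite mevalM mulf_eq0 => /orP[]/eqP; [left|right].
Qed.

Lemma separating_poly C C' : algebraic_set C -> (C `<` C')%classic ->
  exists2 g, forall v, C v -> g.@[v ord0] = 0 &
    exists2 v, C' v & g.@[v ord0] != 0.
Proof.
case=> P -> [_ nsub].
have [v C'v Pv] : exists2 v, C' v & ~ zero_locus P v.
  by apply: contra_notP nsub => nex v C'v; apply: contra_notP nex; exists v.
have [g Pg gv] : exists2 g, P g & g.@[v ord0] != 0.
  apply: contra_notP Pv => nex p Pp; apply/eqP.
  by apply: contra_notT nex => pv; exists p.
by exists g; [move=> v' Pv'; exact: Pv' | exists v].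
Qed.

(** In a relation between the [h a * g ^+ j] on [C'], the lowest power of [g]
    can be cancelled, because [C'] is irreducible and [g] does not vanish on it.
    Restricting to [C], where [g] vanishes, leaves a relation between the [h a]
    alone, so the coefficients of that lowest power are zero. *)
Lemma independent_on_powers (C C' : set 'rV[k]_N) g (A : finType)
    (h : A -> {mpoly k[N]}) (T : nat) :
    irreducible_set C' -> (C `<=` C')%classic ->
    (forall v, C v -> g.@[v ord0] = 0) ->
    (exists2 v, C' v & g.@[v ord0] != 0) -> independent_on C A h ->
  independent_on C' (A * 'I_T)%type (fun aj => h aj.1 * g ^+ aj.2).
Proof.
move=> irrC' CC' g0 [v0 C'v0 gv0] indh u hu.
(* Induction on the power of g, the lower coefficients being known to vanish. *)
suff H (j : nat) : forall a (i : 'I_T), (i <= j)%N -> u (a, i) = 0.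
  by case=> a i; exact: (H i).
have [n] := ubnP j; elim: n => // n IH in j *; rewrite ltnS => jn a i.
rewrite leq_eqVlt => /orP[/eqP ij|]; last first.
  case: j jn => // j jn ij; exact: (IH j).
have u0 b (l : 'I_T) : (l < i)%N -> u (b, l) = 0.
  by move=> li; apply: (IH l) => //; apply: leq_trans jn; rewrite -ij.
pose q := \sum_b \sum_(l : 'I_T | (i <= l)%N) u (b, l) *: (h b * g ^+ (l - i)).
have /(irreducible_mul _ _ _ irrC')[gi0|q0] v : C' v -> (g ^+ i * q).@[v ord0] = 0.
  move=> C'v; rewrite -[RHS](hu v C'v) mulr_sumr raddf_sum /=.
  transitivity (\sum_b \sum_(l < T) u (b, l) * (h b * g ^+ l).@[v ord0]); last first.
    by rewrite pair_bigA; apply: eq_bigr => -[].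
  apply: eq_bigr => b _.
  rewrite [RHS](bigID (fun l : 'I_T => (i <= l)%N)) /= [X in _ = _ + X]big1 ?addr0; last first.
    by move=> l; rewrite -ltnNge => /u0 ->; rewrite mul0r.
  rewrite mulr_sumr raddf_sum /=; apply: eq_bigr => l il.
  by rewrite -scalerAr mevalZ mulrCA -exprD subnKC.
- by move: (gi0 _ C'v0); rewrite rmorphXn /= => /eqP; rewrite expf_eq0 (negPf gv0) andbF.
apply: (indh (fun b => u (b, i))) => v Cv.
rewrite -[RHS](q0 v (CC' v Cv)) raddf_sum /=; apply: eq_bigr => b _.
rewrite raddf_sum (bigD1 i) //= big1 ?addr0 => [|l /andP[il li]].
  by rewrite subnn expr0 mulr1 mevalZ.
rewrite mevalZ mevalM rmorphXn /= g0 // expr0n subn_eq0.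
by rewrite leqNgt ltn_neqAle il eq_sym li /= !mulr0.
Qed.

Lemma supported_pow D g j : supported (fun m => wdeg w m <= D)%N g ->
  supported (fun m => wdeg w m <= j * D)%N (g ^+ j).
Proof.
move=> gD; elim: j => [|j IH].
  by move=> m; rewrite expr0 msupp1 inE => /eqP ->; rewrite unfold_in wdeg0.
rewrite exprS; apply: supportedM gD IH => m1 m2 le1 le2.
by rewrite wdegD mulSn leq_add.
Qed.

(** The polynomials [h a] are the products, with exponents at most [T], of one
    separating polynomial for each step of the chain.  The constant [K] has to be
    independent of [T]: it is the total weight of the separating polynomials. *)
Lemma chain_independent (X : set 'rV[k]_N) (r : nat) (C : nat -> set 'rV[k]_N) :
    irreducible_chain X r C ->
  exists K, forall T, exists (A : finType) (h : A -> {mpoly k[N]}),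
    [/\ #|A| = (T.+1 ^ r)%N,
      forall a, supported (fun m => wdeg w m <= T * K)%N (h a) &
      independent_on (C r) A h].
Proof.
elim: r => [|r IH] [Cirr Cinc].
  exists 0%N => T; exists unit, (fun=> 1); split=> [|_ m|]; first exact: card_unit.
    by rewrite msupp1 inE => /eqP ->; rewrite unfold_in wdeg0.
  move=> u; have [_ [[v Cv] _] _] := Cirr 0%N (leqnn _).
  move=> /(_ v Cv); rewrite (big_pred1 tt); last by case.
  by rewrite meval1 mulr1 => u0 [].
have [K hK] : exists K, forall T, exists (A : finType) (h : A -> {mpoly k[N]}),
    [/\ #|A| = (T.+1 ^ r)%N,
      forall a, supported (fun m => wdeg w m <= T * K)%N (h a) &
      independent_on (C r) A h].
  by apply: IH; split=> i ir; [apply: Cirr; exact: leqW|apply: Cinc; exact: leqW].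
have [_ irrS _] := Cirr r.+1 (leqnn _).
have [algr _ _] := Cirr r (leqnSn _).
have [g g0 gn0] := separating_poly _ _ algr (Cinc r (leqnn _)).
pose E := \max_(m <- msupp g) wdeg w m.
have gE : supported (fun m => wdeg w m <= E)%N g.
  by move=> m mg; rewrite unfold_in; exact: leq_bigmax_seq.
exists (K + E)%N => T; have [A [h [cardA hsupp indh]]] := hK T.
exists (A * 'I_T.+1)%type, (fun aj : A * 'I_T.+1 => h aj.1 * g ^+ aj.2); split.
- by rewrite card_prod cardA card_ord expnSr.
- move=> [a j] /=; apply: supportedM (hsupp a) (supported_pow _ _ j gE) => m1 m2 le1 le2.
  rewrite wdegD mulnDr leq_add //; apply: leq_trans le2 _.
  by rewrite leq_mul2r -ltnS ltn_ord orbT.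
- by apply: independent_on_powers indh => //; case: (Cinc r (leqnn _)).
Qed.

End Chains.

Lemma pow_growth (r e c : nat) :
  (forall T, T.+1 ^ r <= c * T.+1 ^ e)%N -> (r <= e)%N.
Proof.
move=> H; rewrite leqNgt; apply/negP => er.
have := H c; rewrite leqNgt => /negP; apply.
apply: leq_trans (_ : c.+1 ^ e.+1 <= _)%N; last by rewrite leq_pexp2l.
by rewrite expnS ltn_mul2r expn_gt0 ltnSn.
Qed.

(** Two growth rates are compared: the [T.+1 ^ r] independent functions given by
    the chain have weight at most [T * K], hence lie in the span of the standard
    monomials of that weight, which number at most a constant times
    [T.+1 ^ (N - #|J|)]. *)
Theorem chain_length_bound {k : fieldType} {N : nat} (w : 'I_N -> nat)
    (J : finType) (B : J -> {set 'I_N}) (X : set 'rV[k]_N)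
    (r : nat) (C : nat -> set 'rV[k]_N) :
    (forall i, 0 < w i)%N ->
    (forall i j j', i \in B j -> i \in B j' -> j = j') ->
    (forall j, B j != finset.set0) -> block_reducible w J B X ->
  irreducible_chain X r C -> (r + #|J| <= N)%N.
Proof.
move=> w0 disjB Bn0 redB chainC.
have JN := blocks_card_le _ _ disjB Bn0.
have [K hK] := chain_independent w X r C chainC.
have CX : (C r `<=` X)%classic by case: (chainC.1 r (leqnn _)).
rewrite addnC -leq_subRL //; pose c := (N ^ #|J| * K.+1 ^ (N - #|J|))%N.
apply: (@pow_growth _ _ c) => T.
have [A [h [<- hsupp indh]]] := hK T.
have /choice[q qP] a : exists q,
    supported (fun m => (wdeg w m < (T * K).+1)%N && standard J B m) q /\
    forall v, X v -> (h a).@[v ord0] = q.@[v ord0].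
  by have [|q qsupp qE] := standard_reduction _ _ _ _ (T * K).+1 (h a) redB; last by exists q.
pose D := (T * K).+1; pose S := [pred m : 'X_{1..N < D} | standard J B m].
apply: (@leq_trans #|{: {m in S}}|).
  apply: (independent_on_card _ _ _ h (fun m : {m in S} => 'X_[val (val m)])
    (fun a m => (q a)@_(val (val m))) _ indh).
  move=> a v /CX Xv; have [qsupp qE] := qP a.
  have /mpolywE qw : (msize (q a) <= (T * K).+1)%N.
    rewrite msizeE; apply/bigmax_leqP_seq => m /qsupp /andP[mTK _] _.
    exact: leq_ltn_trans (mdeg_le_wdeg _ _ w0) mTK.
  rewrite qE // [X in X.@[_] = _]qw raddf_sum /= (bigID (mem S)) /=.
  rewrite [X in _ + X]big1 ?addr0 => [|m]; last first.
    rewrite inE => nstd; rewrite memN_msupp_eq0 ?scale0r ?raddf0 //.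
    by apply: contra nstd => /qsupp /andP[].
  rewrite -[RHS](big_sub S (fun m : 'X_{1..N < D} =>
    (q a)@_m * ('X_[m] : {mpoly k[N]}).@[v ord0])).
  by apply: eq_bigr => m _; exact: mevalZ.
rewrite card_sig; apply: (leq_trans (card_standard _ _ _ disjB)).
rewrite /c -mulnA -expnMn leq_mul2l; apply/orP; right.
by case: (N - #|J|)%N => // e; rewrite leq_exp2r //; nia.
Qed.

(** * Entries of words in generic matrices *)

Section WordPolynomials.
Context {k : fieldType} {n s : nat}.
Notation N := (n * (s * s))%N.
Implicit Types (l : 'I_n) (i j h : 'I_s) (u : seq 'I_n).

Definition entry_index l i j : 'I_N := mxvec_index l (mxvec_index i j).

Lemma entry_index_inj l l' i i' j j' :
  entry_index l i j = entry_index l' i' j' -> [/\ l = l', i = i' & j = j'].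
Proof.
have inj m1 m2 : injective (uncurry (@mxvec_index m1 m2)).
  move=> x y; case: (curry_mxvec_bij m1 m2) => g gK _ xy.
  by rewrite -[x]gK // -[y]gK // xy.
move=> e; have e1 := inj _ _ (l, _) (l', _) e.
have e2 := inj _ _ (i, j) (i', j') (congr1 snd e1).
by split; [exact: (congr1 fst e1) | exact: (congr1 fst e2) | exact: (congr1 snd e2)].
Qed.

Lemma mx_coordsE (r : {ffun 'I_n -> 'M[k]_s}) l i j :
  mx_coords r ord0 (entry_index l i j) = r l i j.
Proof. by rewrite /mx_coords mxvecE mxE mxvecE. Qed.

Fixpoint word_poly u i j : {mpoly k[N]} :=
  if u is l :: u' then \sum_h 'X_(entry_index l i h) * word_poly u' h j
  else (i == j)%:R.

Lemma word_polyE (r : {ffun 'I_n -> 'M[k]_s}) u i j :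
  (word_poly u i j).@[mx_coords r ord0] = (\big[mulmx/1%:M]_(l <- u) r l) i j.
Proof.
elim: u i => [|l u IH] i /=; first by rewrite big_nil mxE raddfMn /= meval1.
rewrite big_cons mxE raddf_sum /=; apply: eq_bigr => h _.
by rewrite mevalM mevalXU mx_coordsE IH.
Qed.

Section LeadingMonomial.
Variables (x0 : 'I_n) (w0 : seq 'I_n) (M : nat).
Local Notation d := (size w0).

(** The bracket rewards the letter that [w0] prescribes in the layer of [i]; the
    square penalizes uneven steps; [s ^ 2] keeps the weight positive and makes
    longer words heavier. *)
Definition entry_weight l i j : nat :=
  absz ((s ^ 2)%:Z + (nth x0 w0 (i %/ M) == l)%:Z - (j%:Z - i%:Z) ^+ 2)%R.

Lemma entry_weightE l i j : (entry_weight l i j)%:Z =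
  (s ^ 2)%:Z + (nth x0 w0 (i %/ M) == l)%:Z - (j%:Z - i%:Z) ^+ 2.
Proof. rewrite /entry_weight; have := ltn_ord i; have := ltn_ord j; nia. Qed.

Lemma entry_weight_gt0 l i j : (0 < entry_weight l i j)%N.
Proof.
rewrite -ltz_nat entry_weightE; have := ltn_ord i; have := ltn_ord j; nia.
Qed.

Definition weight : 'I_N -> nat :=
  mxvec (\matrix_l mxvec (\matrix_(i, j) entry_weight l i j)) ord0.

Lemma weightE l i j : weight (entry_index l i j) = entry_weight l i j.
Proof. by rewrite /weight mxvecE mxE mxvecE mxE. Qed.

Lemma weight_gt0 a : (0 < weight a)%N.
Proof.
by case/mxvec_indexP: a => l; case/mxvec_indexP => i j; rewrite weightE entry_weight_gt0.
Qed.

Variable step : int.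
Local Notation top := ((s ^ 2)%:Z + 1 + step ^+ 2).
(** The added potential depends on the endpoints of a walk only.  It changes the
    penalty [- x ^+ 2] of an edge of length [x] into
    [step ^+ 2 - (x - step) ^+ 2], so that a walk can be bounded edge by edge:
    each edge contributes at most [top], with equality only for an edge of length
    [step] that carries the prescribed letter. *)
Local Notation tilted i j m := ((wdeg weight m)%:Z + 2 * step * (j%:Z - i%:Z)).

Lemma entry_tilted_le l i h :
  (entry_weight l i h)%:Z + 2 * step * (h%:Z - i%:Z) <= top.
Proof.
rewrite entry_weightE; have := sqr_ge0 (h%:Z - i%:Z - step).
by case: eqP => _; nia.
Qed.

Lemma entry_tilted_lt l i h :
    ~~ ((nth x0 w0 (i %/ M) == l) && (h%:Z == i%:Z + step)) ->
  (entry_weight l i h)%:Z + 2 * step * (h%:Z - i%:Z) < top.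
Proof.
rewrite entry_weightE negb_and.
have := sqr_ge0 (h%:Z - i%:Z - step).
by case: eqP => _ //=; nia.
Qed.

Lemma word_poly_tilted_le u i j :
  supported (fun m => tilted i j m <= (size u)%:Z * top) (word_poly u i j).
Proof.
elim: u i => [|l u IH] i /=.
  case: eqP => [->|_]; last exact: supported0.
  by move=> m; rewrite msupp1 inE => /eqP ->; rewrite unfold_in wdeg0; lia.
apply: supported_sum => h _.
apply: (@supportedM _ _ _ (pred1 U_(entry_index l i h)%MM) _ _ _ _ _ (IH h)).
  move=> _ m2 /eqP -> /=; rewrite wdegD wdeg1 weightE.
  by have := entry_tilted_le l i h; lia.
by apply: supportedX => /=.
Qed.

Lemma word_poly_cons_tilted_lt l u i h j :
    ~~ ((nth x0 w0 (i %/ M) == l) && (h%:Z == i%:Z + step)) ->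
  supported (fun m => tilted i j m < (size u).+1%:Z * top)
    ('X_(entry_index l i h) * word_poly u h j).
Proof.
move=> notstep.
apply: (@supportedM _ _ _ (pred1 U_(entry_index l i h)%MM) _ _ _ _ _
   (word_poly_tilted_le u h j)).
  move=> _ m2 /eqP -> /=; rewrite wdegD wdeg1 weightE.
  by have := entry_tilted_lt l i h notstep; lia.
by apply: supportedX => /=.
Qed.

Variables (a : nat -> 'I_s).
Hypothesis a_step : forall t, (t < d)%N -> (a t.+1)%:Z = (a t)%:Z + step.
Hypothesis a_layer : forall t, (t < d)%N -> (a t %/ M = t)%N.

Definition step_index t := entry_index (nth x0 w0 t) (a t) (a t.+1).

Definition lead_monomial t : 'X_{1..N} := (\sum_(t <= t' < d) U_(step_index t'))%MM.

Lemma lead_monomial_tilted : tilted (a 0%N) (a d) (lead_monomial 0) = d%:Z * top.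
Proof.
suff H t : (t <= d)%N ->
   tilted (a 0%N) (a t) (\sum_(0 <= t' < t) U_(step_index t'))%MM = t%:Z * top.
  exact: H.
elim: t => [|t IH] td; first by rewrite big_nil wdeg0; lia.
rewrite big_nat_recr //= wdegD wdeg1 weightE.
have := IH (ltnW td); have := entry_weightE (nth x0 w0 t) (a t) (a t.+1).
rewrite a_layer // eqxx a_step //; nia.
Qed.

(** A walk loses weight as soon as one edge differs from the corresponding edge
    of the progression [a] labelled by [w0].  For a suffix of [w0] the walk along
    [a] survives with coefficient 1; for any other word of the same length
    nothing reaches the maximum. *)
Lemma word_poly_lead u t : (t + size u)%N = d ->
  supported (fun m => tilted (a t) (a d) m < (size u)%:Z * top)
    (word_poly u (a t) (a d) - (u == drop t w0)%:R *: 'X_[lead_monomial t]).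
Proof.
elim: u t => [|l u IH] t tE.
  rewrite /= in tE; rewrite addn0 in tE; rewrite tE drop_size /= !eqxx /lead_monomial.
  by rewrite big_geq // mpolyX0 scale1r mulr1n !subrr; exact: supported0.
have td : (t < d)%N by rewrite -tE /= addnS ltnS leq_addr.
rewrite (drop_nth x0) // eqseq_cons /=.
have [lE|lN] := eqVneq l (nth x0 w0 t); last first.
  (* A wrong letter makes every first edge strictly light. *)
  rewrite scale0r subr0; apply: supported_sum => h _.
  apply: word_poly_cons_tilted_lt; rewrite a_layer //.
  by rewrite eq_sym (negPf lN).
(* With the right letter, only the first edge to a t.+1 is not strictly light. *)
rewrite (bigD1 (a t.+1)) //= [X in supported _ X]addrAC; apply: supportedD; last first.
  apply: supported_sum => h ha; apply: word_poly_cons_tilted_lt.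
  by rewrite -a_step // eqz_nat val_eqE (negPf ha) andbF.
have -> : lead_monomial t = (U_(entry_index l (a t) (a t.+1)) + lead_monomial t.+1)%MM.
  by rewrite /lead_monomial big_ltn // lE.
rewrite mpolyXD scalerAr -mulrBr.
apply: (@supportedM _ _ _ (pred1 U_(entry_index l (a t) (a t.+1))%MM) _ _ _ _ _
  (IH t.+1 _)); last by rewrite addSnnS.
  move=> _ m2 /eqP -> /=; rewrite wdegD wdeg1 weightE.
  by have := entry_tilted_le l (a t) (a t.+1); lia.
by apply: supportedX => /=.
Qed.

Lemma a_span t : (t <= d)%N -> (a t)%:Z = (a 0%N)%:Z + t%:Z * step.
Proof.
elim: t => [|t IH] td; first by lia.
by rewrite a_step // IH 1?ltnW //; lia.
Qed.

(** Words shorter than [w0] lose [top] for each missing letter, while the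
    potential between the two endpoints is the same for all words. *)
Lemma word_poly_lt_lead u : (size u <= d)%N ->
  supported (fun m => wdeg weight m < wdeg weight (lead_monomial 0))%N
    (word_poly u (a 0%N) (a d) - (u == w0)%:R *: 'X_[lead_monomial 0]).
Proof.
rewrite leq_eqVlt => /orP[/eqP ud|ud].
  have := word_poly_lead u 0 ud; rewrite drop0; apply: supported_sub => m.
  rewrite ud -lead_monomial_tilted; lia.
have /negPf -> : u != w0 by apply: contraTneq ud => ->; rewrite ltnn.
rewrite scale0r subr0; apply: supported_sub (word_poly_tilted_le u _ _) => m /=.
by have := lead_monomial_tilted; rewrite a_span //; nia.
Qed.

(** Among the words of [Q] only [w0] contributes the leading monomial, so its
    coefficient in the entry is that of [w0] in [Q], which is nonzero in every
    characteristic. *)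
Lemma nceval_lead (Q : ncpoly k n) (W : monalg.fmonom 'I_n) :
    W = w0 :> seq 'I_n -> W \in monalg.msupp Q -> (ncdegree Q <= d)%N ->
  exists2 g : {mpoly k[N]},
    supported (fun m => wdeg weight m < wdeg weight (lead_monomial 0))%N g &
    forall r, nceval r Q = 0 ->
      'X_[lead_monomial 0].@[mx_coords r ord0] = g.@[mx_coords r ord0].
Proof.
move=> Ww0 WQ degQ; pose c := monalg.mcoeff W Q.
have c0 : c != 0 by rewrite monalg.mcoeff_neq0.
pose f : {mpoly k[N]} := \sum_(w <- monalg.msupp Q)
  monalg.mcoeff w Q *: word_poly w (a 0%N) (a d).
exists ('X_[lead_monomial 0] - c^-1 *: f); last first.
  move=> r rQ; rewrite mevalB mevalZ.
  suff -> : f.@[mx_coords r ord0] = 0 by rewrite mulr0 subr0.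
  rewrite -[RHS](_ : (0 : 'M[k]_s) (a 0%N) (a d) = 0); last by rewrite mxE.
  rewrite -rQ /nceval summxE raddf_sum /=; apply: eq_bigr => w _.
  by rewrite mevalZ word_polyE mxE.
have fE : f - c *: 'X_[lead_monomial 0] = \sum_(w <- monalg.msupp Q)
    monalg.mcoeff w Q *:
      (word_poly w (a 0%N) (a d) - (w == w0 :> seq 'I_n)%:R *: 'X_[lead_monomial 0]).
  under eq_bigr => w _ do rewrite scalerBr.
  rewrite sumrB; congr (_ - _).
  rewrite (bigD1_seq W) //= ?big1 ?addr0 //.
  - by rewrite Ww0 eqxx scale1r.
  - move=> w wW; rewrite -Ww0 val_eqE (negPf wW) scale0r scaler0 //.
  - exact: finmap.fset_uniq.
have -> : 'X_[lead_monomial 0] - c^-1 *: f = (- c^-1) *: (f - c *: 'X_[lead_monomial 0]).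
  by rewrite scalerBr !scaleNr scalerA mulVf // scale1r opprK addrC.
rewrite fE.
apply: supportedZ; rewrite big_seq; apply: supported_sum => w wQ.
apply: supportedZ; apply: word_poly_lt_lead; apply: leq_trans degQ.
exact: leq_bigmax_seq.
Qed.

End LeadingMonomial.
End WordPolynomials.

(** * Disjoint progressions *)

Section Progressions.
Context {k : fieldType} {n s : nat}.
Variables (s_gt0 : (0 < s)%N) (x0 : 'I_n).
Variables (w0 : seq 'I_n) (w0_gt0 : (0 < size w0)%N).
Local Notation d := (size w0).
Variable m : nat.
Hypothesis ms : ((d.+1 ^ 2) * m <= s)%N.
Local Notation M := (d.+1 * m)%N.
Implicit Types x y : 'I_m * 'I_m.

(** The start [x.1] and the excess [x.2] of the step over [M] are both less than
    [m], and the total drift [x.1 + t * x.2] stays below [M = d.+1 * m]: after [t]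
    steps the progression is in layer [t]. *)
Definition progression x (t : nat) : 'I_s :=
  insubd (Ordinal s_gt0) (x.1 + t * (M + x.2))%N.

Lemma progressionE x t : (t <= d)%N -> progression x t = (x.1 + t * (M + x.2))%N :> nat.
Proof.
move=> td; rewrite val_insubd ifT //; case: x => [[p /= pm] [e /= em]].
apply: leq_trans ms.
have : (t * (M + e) <= d * (M + e))%N by rewrite leq_mul2r td orbT.
nia.
Qed.

Lemma progression_layer x t : (t < d)%N -> (progression x t %/ M = t)%N.
Proof.
move=> td; rewrite progressionE ?(ltnW td) //; case: x => [[p /= pm] [e /= em]].
have -> : (p + t * (M + e) = t * M + (p + t * e))%N by lia.
rewrite divnMDl; last by nia.
rewrite divn_small ?addn0 //.
have : (t * e <= d * e)%N by rewrite leq_mul2r (ltnW td) orbT.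
nia.
Qed.

Lemma progression_step x t : (t < d)%N ->
  (progression x t.+1)%:Z = (progression x t)%:Z + (M + x.2)%N%:Z.
Proof. by move=> td; rewrite !progressionE ?(ltnW td) //; lia. Qed.

Definition progression_block x : {set 'I_(n * (s * s))} :=
  [set step_index x0 w0 (progression x) t | t : 'I_d].

(** The source of an edge gives its layer [t]; the difference of target and
    source gives the step, and then the source gives the start. *)
Lemma step_index_progression_inj x y (t t' : 'I_d) :
  step_index x0 w0 (progression x) t = step_index x0 w0 (progression y) t' ->
  t = t' /\ x = y.
Proof.
move=> /entry_index_inj[_ e0 e1].
have tt' : t = t' :> nat.
  by rewrite -(progression_layer x t) // e0 progression_layer.
split; first exact: val_inj.
have := congr1 val e0; have := congr1 val e1.
rewrite /= tt' !progressionE // ?(ltnW (ltn_ord t')) //.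
case: x y {e0 e1} => [p e] [p' e'] /= h1 h0.
have ee' : e = e' by apply: val_inj => /=; nia.
by move: h0; rewrite ee' => /addIn /val_inj ->.
Qed.

Lemma progression_block_disjoint i x y :
  i \in progression_block x -> i \in progression_block y -> x = y.
Proof.
by move=> /imsetP[t _ ->] /imsetP[t' _ /step_index_progression_inj[]].
Qed.

Lemma progression_block_neq0 x : progression_block x != finset.set0.
Proof.
by apply/set0Pn; eexists; apply/imsetP; exists (Ordinal w0_gt0).
Qed.

Lemma progression_block_monomial x :
  block_monomial _ progression_block x = lead_monomial x0 w0 (progression x) 0.
Proof.
rewrite /block_monomial /lead_monomial big_mkord big_imset //=.
by move=> t t' _ _ /step_index_progression_inj[].
Qed.

Lemma MsQ_chain_length (Q : ncpoly k n) (W : monalg.fmonom 'I_n) r C :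
    W = w0 :> seq 'I_n -> W \in monalg.msupp Q -> (ncdegree Q <= d)%N ->
    irreducible_chain (image (MsQ s Q) (@mx_coords k n s)) r C ->
  (r + m ^ 2 <= n * (s * s))%N.
Proof.
move=> Ww0 WQ degQ chainC.
have -> : (m ^ 2 = #|{: 'I_m * 'I_m}|)%N by rewrite card_prod card_ord.
apply: (chain_length_bound (weight x0 w0 M) _ progression_block _ _ _ _ _ _ _ chainC).
- exact: weight_gt0.
- exact: progression_block_disjoint.
- exact: progression_block_neq0.
move=> x; rewrite progression_block_monomial.
have [g gsupp gE] := nceval_lead x0 w0 M _ _ (progression_step x)
  (progression_layer x) Q W Ww0 WQ degQ.
by exists g => // _ [q qQ <-]; exact: gE.
Qed.

End Progressions.

(** * The codimension bound *)

Lemma ncdegree_attained (k : fieldType) (n : nat) (Q : ncpoly k n) :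
  (0 < ncdegree Q)%N ->
  exists2 W, W \in monalg.msupp Q & size W = ncdegree Q.
Proof.
move=> Q0; have : ~~ (ncdegree Q <= (ncdegree Q).-1)%N by rewrite -ltnNge prednK.
pose short (w : monalg.fmonom 'I_n) := (size w < ncdegree Q)%N.
case: (boolP (all short (monalg.msupp Q))).
  move=> /allP small /negP[]; apply/bigmax_leqP_seq => w wQ _.
  by rewrite -ltnS prednK //; exact: small.
move=> /allPn[W WQ]; rewrite /short -leqNgt => WD _; exists W => //.
by apply/eqP; rewrite eqn_leq WD andbT; exact: leq_bigmax_seq.
Qed.

(** With y = s / D and z its integral part, y <= z + 1, whence
    y^2 / 2 - 1 <= (z + 1)^2 / 2 - 1 <= z^2. *)
Lemma divn_square_ge (R : realType) (s D : nat) : (0 < D)%N ->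
  (2 * D%:R ^+ 2)^-1 * s%:R ^+ 2 - 1 <= ((s %/ D) ^ 2)%:R :> R.
Proof.
move=> D0; have Dr : 0 < D%:R :> R by rewrite ltr0n.
have le : (s%:R : R) / D%:R <= (s %/ D)%:R + 1.
  rewrite ler_pdivrMr // natr1 -natrM ler_nat mulSn addnC.
  by rewrite {1}(divn_eq s D) leq_add2l ltnW // ltn_pmod.
have -> : (2 * D%:R ^+ 2)^-1 * s%:R ^+ 2 = (s%:R / D%:R) ^+ 2 / 2 :> R.
  by field; rewrite ?lt0r_neq0.
have y0 : 0 <= s%:R / D%:R :> R by rewrite divr_ge0 ?ler0n.
rewrite natrX; move: le y0; set y := s%:R / D%:R; set z := (s %/ D)%:R => le y0.
have := sqr_ge0 (z - 1).
have : y ^+ 2 <= (z + 1) ^+ 2 by rewrite lerXn2r ?nnegrE // (le_trans y0).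
rewrite !expr2; nra.
Qed.

Local Open Scope classical_set_scope.

Theorem theorem3 (k : closedFieldType) (R : realType) (d : nat) (hd : (0 < d)%N) :
  exists a b : R, 0 < a /\
    forall n : nat, (0 < n)%N ->
    forall Q : ncpoly k n, Q != 0 -> ncdegree Q = d ->
    forall s : nat, (0 < s)%N ->
      ((a * s%:R ^+ 2 + b)%:E <= mx_codim R (MsQ s Q))%E.
Proof.
pose D := (d.+1 ^ 2)%N.
(* The codimension is at least (s %/ D) ^ 2; halving 1 / D^2 and subtracting 1
   absorbs the rounding. *)
exists (2 * D%:R ^+ 2)^-1, (-1); split.
  by rewrite invr_gt0 mulr_gt0 ?exprn_gt0 ?ltr0n // expn_gt0.
move=> n n0 Q _ degQ s s0.
pose c := ((s %/ D) ^ 2)%N.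
apply: (@le_trans _ _ c%:R%:E).
  by rewrite lee_fin divn_square_ge // expn_gt0.
have [|W WQ sizeW] := ncdegree_attained _ _ Q; first by rewrite degQ.
have W0 : (0 < size W)%N by rewrite sizeW degQ.
have le_dim : (alg_dim R (image (MsQ s Q) (@mx_coords k n s)) <=
    ((n * (s * s))%:R - c%:R)%:E)%E.
  apply: ge_ereal_sup => _ [r [C chainC] <-].
  rewrite lee_fin lerBrDr -natrD ler_nat.
  apply: (MsQ_chain_length s0 (Ordinal n0) W W0 _ _ Q W r C erefl WQ _ chainC).
    by rewrite sizeW degQ mulnC leq_trunc_div.
  by rewrite sizeW.
rewrite /mx_codim /alg_codim.
apply: le_trans (leeB (lexx _) le_dim).
by rewrite -EFinB lee_fin opprB addrC subrK.
Qed.
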